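(* For every integer $n>0$, the parity game $\mathcal{G}_n$ defined in the context has $14\cdot n+11$ nodes, $3\cdot n^2+28\cdot n+17$ edges, and $16\cdot n+16$ as its highest priority. In particular, $|\mathcal{G}_n|=\mathcal{O}(n^2)$.
   Context: A parity game is a tuple $G=(V,V_0,V_1,E,\Omega)$ where $(V,E)$ is a finite directed graph in which every node has at least one successor, $V=V_0\cup V_1$ is a disjoint union ($V_i$ is the set of nodes owned by player $i$), and $\Omega:V\to\mathbb{N}$ is the priority function. The size of $G$ is $|G|:=|E|$, the number of edges. **The game $\mathcal{G}_n$** ($n>0$). Player 0 owns $y,d,s,t,x,w$, $b_0,\ldots,b_{3n}$, and $e_i,f_i,g_i,l_i,z_i$ for $0\le i<n$. Player 1 owns $c,p,q$, $a_0,\ldots,a_{3n}$, and $h_i,k_i,m_i$ for $0\le i<n$. All these nodes are distinct. Priorities and successor sets (indices $j\ge 0$) are: - $s$: priority $2$, successors $\{p\}\cup\{k_j\mid j<n\}$ - $t$: priority $3$, successors $\{x,s\}$ - $y$: priority $5$, successors $\{l_0,w\}$ - $w$: priority $7$, successors $\{p,y\}\cup\{l_j\mid 0<j<n\}$ - $b_0$: priority $6n+9$, successors $\{s,x,d\}$ - $b_i$ ($0<i\le 3n$): priority $6n+2i+9$, successors $\{s,x,b_{i-1}\}$ - $a_i$ ($0\le i\le 3n$): priority $6n+2i+10$, successors $\{b_i\}$ - $c$: priority $12n+11$, successors $\{d\}$ - $d$: priority $12n+12$, successors $\{t,x\}$ - $x$: priority $12n+14$, successors $\{w,y\}$ - $e_i$: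 priority $6i+9$, successors $\{s,f_i,c\}\cup\{a_{3j+2}\mid j\le i\}$ - $f_i$: priority $6i+11$, successors $\{g_i\}\cup\{a_{3j+1}\mid j\le i\}\cup\{k_j\mid j<n\}$ - $g_i$: priority $6i+13$, successors $\{h_i\}\cup\{a_{3j}\mid j\le i+1\}$ - $h_i$: priority $6i+14$, successors $\{e_i,m_i\}$ - $l_i$: priority $6i+10$, successors $\{k_i,z_i\}$ - $z_i$: priority $12n+4i+15$, successors $\{p\}\cup\{l_j\mid i<j<n\}$ - $k_i$: priority $12n+4i+17$, successors $\{h_i\}$ - $m_i$: priority $12n+4i+18$, successors $\{z_i\}$ - $q$: priority $1$, successors $\{q\}$ - $p$: priority $16n+16$, successors $\{q\}$ (with $0\le i<n$ for $e_i,f_i,g_i,h_i,l_i,z_i,k_i,m_i$). *)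

(* Defs.v *)
From HB Require Import structures.
From mathcomp Require Import all_boot.

Set Implicit Arguments.
Unset Strict Implicit.
Unset Printing Implicit Defensive.

Local Open Scope nat_scope.

Record parity_game := ParityGame {
  pg_node : finType;
  pg_V0 : {set pg_node};
  pg_V1 : {set pg_node};
  pg_edges : {set pg_node * pg_node};
  pg_priority : pg_node -> nat;
  pg_cover : (pg_V0 :|: pg_V1) = [set: pg_node];
  pg_disjoint : [disjoint pg_V0 & pg_V1];
  pg_total : forall u, exists v, (u, v) \in pg_edges
}.

Definition pg_size (G : parity_game) : nat := #|pg_edges G|.

Definition pg_max_priority (G : parity_game) : nat :=
  \max_(v : pg_node G) pg_priority v.

Inductive gnode (n : nat) : Type :=
| vy | vd | vs | vt | vx | vw | vc | vp | vq
| va of 'I_(3 * n).+1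
| vb of 'I_(3 * n).+1
| ve of 'I_n
| vf of 'I_n
| vg of 'I_n
| vl of 'I_n
| vz of 'I_n
| vh of 'I_n
| vk of 'I_n
| vm of 'I_n.

Arguments vy {n}. Arguments vd {n}. Arguments vs {n}. Arguments vt {n}.
Arguments vx {n}. Arguments vw {n}. Arguments vc {n}. Arguments vp {n}.
Arguments vq {n}.

Section GnodeFinite.
Variable n : nat.

Let code : Type := ('I_9 + (bool * 'I_(3 * n).+1 + 'I_8 * 'I_n))%type.

Definition gnode_code (v : gnode n) : code :=
  let u k : code := inl (inord k) in
  let r k i : code := inr (inr (inord k, i)) in
  match v with
  | vy => u 0 | vd => u 1 | vs => u 2 | vt => u 3 | vx => u 4 | vw => u 5
  | vc => u 6 | vp => u 7 | vq => u 8
  | va i => inr (inl (false, i))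
  | vb i => inr (inl (true, i))
  | ve i => r 0 i | vf i => r 1 i | vg i => r 2 i | vl i => r 3 i
  | vz i => r 4 i | vh i => r 5 i | vk i => r 6 i | vm i => r 7 i
  end.

Definition gnode_decode (c : code) : gnode n :=
  match c with
  | inl k => nth vq [:: vy; vd; vs; vt; vx; vw; vc; vp] k
  | inr (inl (false, i)) => va i
  | inr (inl (true, i)) => vb i
  | inr (inr (k, i)) =>
      nth (@vm n) [:: @ve n; @vf n; @vg n; @vl n; @vz n; @vh n; @vk n] k i
  end.

Lemma gnode_codeK : cancel gnode_code gnode_decode.
Proof. by case=> [|||||||||i|i|i|i|i|i|i|i|i|i] /=; rewrite ?inordK. Qed.

HB.instance Definition _ := Finite.copy (gnode n) (can_type gnode_codeK).

End GnodeFinite.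

Definition gn_V0 (n : nat) : {set gnode n} :=
  [set v | match v with
           | vy | vd | vs | vt | vx | vw
           | vb _ | ve _ | vf _ | vg _ | vl _ | vz _ => true
           | _ => false
           end].

Definition gn_V1 (n : nat) : {set gnode n} :=
  [set v | match v with
           | vc | vp | vq | va _ | vh _ | vk _ | vm _ => true
           | _ => false
           end].

Definition gn_priority (n : nat) (v : gnode n) : nat :=
  match v with
  | vs => 2
  | vt => 3
  | vy => 5
  | vw => 7
  | vb i => 6 * n + 2 * i + 9
  | va i => 6 * n + 2 * i + 10
  | vc => 12 * n + 11
  | vd => 12 * n + 12
  | vx => 12 * n + 14
  | ve i => 6 * i + 9
  | vf i => 6 * i + 11
  | vg i => 6 * i + 13
  | vh i => 6 * i + 14
  | vl i => 6 * i + 10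
  | vz i => 12 * n + 4 * i + 15
  | vk i => 12 * n + 4 * i + 17
  | vm i => 12 * n + 4 * i + 18
  | vq => 1
  | vp => 16 * n + 16
  end.

(* Every argument of [inord] below is at most [3 * n], so [inord] never falls
   back to its default value. The node l_0 is written as the l_j with
   [j = 0 :> nat], so that the definition also makes sense for [n = 0]. *)
Definition gn_succ (n : nat) (v : gnode n) : {set gnode n} :=
  match v with
  | vs => vp |: [set vk j | j : 'I_n]
  | vt => [set vx; vs]
  | vy => [set vl j | j : 'I_n & j == 0 :> nat] :|: [set vw]
  | vw => [set vp; vy] :|: [set vl j | j : 'I_n & 0 < j]
  | vb i => if i == 0 :> nat then [set vs; vx; vd]
            else [set vs; vx; vb (inord i.-1)]
  | va i => [set vb i]
  | vc => [set vd]
  | vd => [set vt; vx]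
  | vx => [set vw; vy]
  | ve i => [set vs; vf i; vc] :|: [set va (inord (3 * j + 2)) | j : 'I_n & j <= i]
  | vf i => vg i |: [set va (inord (3 * j + 1)) | j : 'I_n & j <= i]
              :|: [set vk j | j : 'I_n]
  | vg i => vh i |: [set va (inord (3 * j)) | j : 'I_n.+1 & j <= i.+1]
  | vh i => [set ve i; vm i]
  | vl i => [set vk i; vz i]
  | vz i => vp |: [set vl j | j : 'I_n & i < j]
  | vk i => [set vh i]
  | vm i => [set vz i]
  | vq => [set vq]
  | vp => [set vq]
  end.

Definition gn_edges (n : nat) : {set gnode n * gnode n} :=
  [set uv | uv.2 \in gn_succ uv.1].

Lemma gn_cover n : (gn_V0 n :|: gn_V1 n) = [set: gnode n].
Proof. by apply/setP; case=> *; rewrite !inE. Qed.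

Lemma gn_disjoint n : [disjoint gn_V0 n & gn_V1 n].
Proof. by rewrite -setI_eq0; apply/eqP/setP; case=> *; rewrite !inE. Qed.

Lemma gn_total n (u : gnode n) : exists v, (u, v) \in gn_edges n.
Proof.
pose v : gnode n :=
  match u with
  | vs => vp | vt => vx | vy => vw | vw => vp | vb _ => vs | va i => vb i
  | vc => vd | vd => vt | vx => vw | ve _ => vs | vf i => vg i | vg i => vh i
  | vh i => ve i | vl i => vk i | vz _ => vp | vk i => vh i | vm i => vz i
  | vq => vq | vp => vq
  end.
by exists v; rewrite {}/v; case: u => *; rewrite !inE /=; do ?case: ifP;
  rewrite ?inE ?eqxx ?orbT.
Qed.

Definition Gn (n : nat) : parity_game :=
  ParityGame (@gn_priority n) (gn_cover n) (gn_disjoint n) (@gn_total n).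

(* Main.v *)
(* The edges are counted by out-degree, using deg y = 2, deg s = deg w = n + 1,
   deg a_i = 1, deg b_i = 3, deg e_i = i + 4, deg f_i = i + n + 2,
   deg g_i = i + 3 and deg z_i = n - i; all remaining degrees are 1 or 2.  The
   highest priority is the one of p. *)

Require Import Defs.
From mathcomp Require Import all_boot all_order all_algebra.
From mathcomp Require Import all_classical all_reals all_analysis.
From mathcomp Require Import zify.
Import Order.TTheory GRing.Theory Num.Theory numFieldNormedType.Exports.
Local Open Scope classical_set_scope.

(** The [nth] defaults [vq] and [vm] are reached only at the last indices, 8 and 7, so no two codes
    decode to the same node. With [gnode_codeK] this makes decoding a bijection, which allows sums
    over nodes to be reindexed by codes. *)
Lemma gnode_decodeK n : cancel (@gnode_decode n) (@gnode_code n).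
Proof.
case=> [[k lt_k]|[[[] i]|[[k lt_k] i]]] //=.
  move: k lt_k => [|[|[|[|[|[|[|[|[|k]]]]]]]]] lt_k //=;
    by congr inl; apply/val_inj; rewrite /= inordK.
move: k lt_k => [|[|[|[|[|[|[|[|k]]]]]]]] lt_k //=;
  by congr (inr (inr (_, i))); apply/val_inj; rewrite /= inordK.
Qed.

(** Serves both counts: [F] constantly 1 gives the nodes, [F] the out-degree gives the edges. *)
Lemma sum_gnode n (F : gnode n -> nat) :
  (\sum_v F v =
     F vy + F vd + F vs + F vt + F vx + F vw + F vc + F vp + F vq
     + \sum_(i < (3 * n).+1) (F (va i) + F (vb i))
     + \sum_(i < n) (F (ve i) + F (vf i) + F (vg i) + F (vl i)
                     + F (vz i) + F (vh i) + F (vk i) + F (vm i)))%N.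
Proof.
rewrite (reindex (@gnode_decode n)) /=; last first.
  by exists (@gnode_code n) => v _; rewrite (gnode_codeK, gnode_decodeK).
rewrite !big_sumType /= !addnA; congr (_ + _ + _)%N.
- by rewrite !big_ord_recl big_ord0 /= addn0 !addnA.
- transitivity (\sum_b \sum_i F (gnode_decode (inr (inl (b, i)))))%N.
    by rewrite pair_bigA; apply: eq_bigr => -[].
  by rewrite big_bool /= addnC big_split.
transitivity (\sum_k \sum_i F (gnode_decode (inr (inr (k, i)))))%N.
  by rewrite pair_bigA; apply: eq_bigr => -[].
by rewrite !big_ord_recl big_ord0 /= addn0 !big_split /= !addnA.
Qed.

Lemma card_gnode n : #|{: gnode n}| = (14 * n + 11)%N.
Proof. by rewrite -sum1_card sum_gnode !sum_nat_const !card_ord; lia. Qed.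

Lemma card_ord_ltn n m : (m <= n)%N -> #|[set j : 'I_n | (j < m)%N]%SET| = m.
Proof.
move=> le_mn; rewrite -sum1dep_card -(big_ord_widen _ (fun=> 1%N)) //.
by rewrite sum1_card card_ord.
Qed.

Lemma card_ord_leq n m : (m < n)%N -> #|[set j : 'I_n | (j <= m)%N]%SET| = m.+1.
Proof. exact: card_ord_ltn. Qed.

Lemma card_ord_gtn n m :
  (m < n)%N -> #|[set j : 'I_n | (m < j)%N]%SET| = (n - m.+1)%N.
Proof.
move=> lt_mn; rewrite -[n in RHS]card_ord.
rewrite -(cardsC [set j : 'I_n | (j < m.+1)%N]%SET) card_ord_ltn // addKn.
by apply: eq_card => j; rewrite !inE -leqNgt.
Qed.

(** When [x] and [f a] start with different constructors, [//] closes the premise; this is how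
    successors of different kinds are separated below. *)
Lemma notin_imset (aT rT : finType) (f : aT -> rT) (A : {pred aT}) (x : rT) :
  (forall a, x <> f a) -> x \in imset f (mem A) = false.
Proof. by move=> neq; apply/imsetP => -[a _ /neq]. Qed.

Lemma card_gn_edges n : #|gn_edges n| = (\sum_u #|@gn_succ n u|)%N.
Proof.
pose E (u v : gnode n) := v \in gn_succ u.
rewrite -sum1_card (eq_bigl (fun uv => xpredT uv.1 && E uv.1 uv.2)).
  rewrite -(pair_big_dep xpredT E (fun _ _ => 1%N)).
  by apply: eq_bigr => u _; rewrite sum1_card.
by move=> uv; rewrite !inE.
Qed.

Lemma card_succ_vs n : #|gn_succ (@vs n)| = n.+1.
Proof.
rewrite /= cardsU1 card_imset ?card_ord; last by move=> ? ? [].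
by rewrite notin_imset.
Qed.

Lemma card_succ_vy n : (0 < n)%N -> #|gn_succ (@vy n)| = 2.
Proof.
move=> n_gt0 /=; rewrite finset.setUC cardsU1 card_imset; last by move=> ? ? [].
(* The second 1 is read as the number of [j < 1] in ['I_n], which is where [0 < n] enters: the node
   l_0 must exist. *)
rewrite notin_imset // -[2]/(1 + 1)%N -[X in _ = (_ + X)%N](@card_ord_ltn n 1) //.
by congr addn; apply: eq_card => j; rewrite !inE ltnS leqn0.
Qed.

Lemma card_succ_vw n : (0 < n)%N -> #|gn_succ (@vw n)| = n.+1.
Proof.
move=> n_gt0 /=; rewrite -finset.setUA !cardsU1 !inE card_imset; last first.
  by move=> ? ? [].
rewrite card_ord_gtn // !notin_imset //; case: eqP => // _.
by lia.
Qed.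

Lemma card_succ_vb n i : #|gn_succ (@vb n i)| = 3.
Proof.
by rewrite /=; case: ifP => _; rewrite -finset.setUA !cardsU1 cards1 !inE;
  do 3?[case: eqP => // _].
Qed.

(** The bound keeps every [f j] in the range where [inord] is faithful, so injectivity of [f]
    carries over to the nodes. *)
Lemma card_imset_va n m (f : 'I_m -> nat) (A : {set 'I_m}) :
  {in A &, injective f} -> (forall j, j \in A -> (f j <= 3 * n)%N) ->
  #|[set @va n (inord (f j)) | j in A]%SET| = #|A|.
Proof.
move=> f_inj le_f; rewrite card_in_imset // => i j Ai Aj [].
move/(congr1 val); rewrite /= !inordK ?ltnS ?le_f //.
exact: f_inj.
Qed.

Lemma card_succ_ve n i : #|gn_succ (@ve n i)| = (i + 4)%N.
Proof.
rewrite /= -!finset.setUA !cardsU1 !inE card_imset_va; first last.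
- by move=> j; rewrite inE; have := ltn_ord j; have := ltn_ord i; lia.
- by move=> j k _ _ eq_jk; apply: val_inj => /=; lia.
rewrite !notin_imset // card_ord_leq //; do 3?[case: eqP => // _].
by lia.
Qed.

Lemma card_succ_vf n i : #|gn_succ (@vf n i)| = (i + n + 2)%N.
Proof.
rewrite /= -!finset.setUA cardsU1 !inE cardsU.
rewrite card_imset_va; first last.
- by move=> j; rewrite inE; have := ltn_ord j; have := ltn_ord i; lia.
- by move=> j k _ _ eq_jk; apply: val_inj => /=; lia.
rewrite card_imset ?card_ord; last by move=> ? ? [].
rewrite !notin_imset //.
(* The a-successors and the k-successors are disjoint, so their numbers add up. *)
rewrite (_ : (_ :&: _)%SET = finset.set0) ?cards0; last first.
  apply/finset.setP => v; rewrite !inE.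
  by apply/negP => /andP[/imsetP[? _ ->] /imsetP[]].
by rewrite card_ord_leq //; lia.
Qed.

Lemma card_succ_vg n i : #|gn_succ (@vg n i)| = (i + 3)%N.
Proof.
rewrite /= cardsU1 notin_imset //.
rewrite card_imset_va; first last.
(* Here [j] ranges up to [n] inclusive, so [3 * j] may equal [3 * n], the last index of an
   a-node. *)
- by move=> j; rewrite inE; have := ltn_ord j; have := ltn_ord i; lia.
- by move=> j k _ _ eq_jk; apply: val_inj => /=; lia.
by rewrite card_ord_leq //; have := ltn_ord i; lia.
Qed.

Lemma card_succ_vz n i : #|gn_succ (@vz n i)| = (n - i)%N.
Proof.
rewrite /= cardsU1 notin_imset //.
rewrite card_imset ?card_ord_gtn //; last by move=> ? ? [].
by have := ltn_ord i; lia.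
Qed.

Lemma cards2_neq (T : finType) (x y : T) : x <> y -> #|[set x; y]%SET| = 2.
Proof. by move/eqP; rewrite cards2 => ->. Qed.

Lemma size_Gn n : (0 < n)%N -> pg_size (Gn n) = (3 * n ^ 2 + 28 * n + 17)%N.
Proof.
move=> n_gt0; rewrite /pg_size /= card_gn_edges sum_gnode.
rewrite card_succ_vs card_succ_vy // card_succ_vw //.
under eq_bigr do rewrite card_succ_vb /= cards1.
under [X in (_ + X)%N]eq_bigr => i _.
  rewrite card_succ_ve card_succ_vf card_succ_vg card_succ_vz /=.
  rewrite !cards1 !cards2_neq //.
  (* Total out-degree of the eight nodes of index [i]; [i < n] lets the truncated [n - i] cancel one
     of the three [i]. *)
  rewrite (_ : (_ + _)%N = (2 * i + (2 * n + 15))%N); last first.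
    by have := ltn_ord i; lia.
  over.
rewrite [X in (_ + X)%N]big_split /= -big_distrr /= !sum_nat_const !card_ord.
rewrite !cards1 !cards2_neq //.
(* The sum of all [i < n] is ['C(n, 2)], and [mul_bin_diag] turns its double into [n * n.-1]. *)
have := bin2_sum n; rewrite big_mkord => ->.
have := mul_bin_diag n 1; rewrite bin1.
by rewrite expnS expn1; nia.
Qed.

Lemma max_priority_Gn n : (0 < n)%N -> pg_max_priority (Gn n) = (16 * n + 16)%N.
Proof.
move=> n_gt0; apply/eqP; rewrite eqn_leq; apply/andP; split.
  (* The closest competitor of p is m_{n-1}, of priority 16n + 14. *)
  by apply/bigmax_leqP => -[|||||||||i|i|i|i|i|i|i|i|i|i] _ /=;
    try (have := ltn_ord i); lia.
exact: (leq_bigmax (vp : pg_node (Gn n))).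
Qed.

Theorem corollary6 (R : realType) :
  (forall n : nat, (0 < n)%N ->
     [/\ #|pg_node (Gn n)| = (14 * n + 11)%N,
         pg_size (Gn n) = (3 * n ^ 2 + 28 * n + 17)%N
       & pg_max_priority (Gn n) = (16 * n + 16)%N])
  /\ ((fun n : nat => ((pg_size (Gn n))%:R : R^o)%R)
        =O_\oo (fun n : nat => ((n ^ 2)%:R : R^o)%R)).
Proof.
split=> [n n_gt0|].
  by split; [exact: card_gnode | exact: size_Gn | exact: max_priority_Gn].
apply/eqOP; near=> k; near=> n.
have n_gt0 : (0 < n)%N by near: n; exact: nbhs_infty_gt.
(* 48 = 3 + 28 + 17, since both n and 1 are at most n^2 once n > 0. *)
rewrite !normr_nat (@le_trans _ _ (48%:R * (n ^ 2)%:R)%R) //.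
  by rewrite -natrM ler_nat size_Gn //; nia.
by apply: ler_wpM2r => //; near: k; exact: nbhs_pinfty_ge.
Unshelve. all: by end_near.
Qed.
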